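(* Let $k \geq 7$ be an odd integer and let $G$ be a (finite, simple) graph on $n$ vertices that contains no cycle of odd length $\ell$ with $3 \leq \ell < k$. Then $G$ contains at most $(n/k)^k$ cycles of length $k$. Moreover, the balanced blow-up of a $k$-cycle is the only graph attaining this maximum, i.e., the only such graph $G$ with exactly $(n/k)^k$ cycles of length $k$.
   Context: Cycles of length $k$ are counted as subgraphs of $G$ isomorphic to the cycle $C_k$ (so each cycle is counted once, regardless of starting vertex or orientation). The balanced blow-up of a $k$-cycle on $n$ vertices (defined when $k$ divides $n$) is the graph obtained from the cycle $v_0v_1\ldots v_{k-1}$ by replacing each vertex $v_i$ with an independent set $V_i$ of size $n/k$, and joining every vertex of $V_i$ to every vertex of $V_j$ whenever $v_iv_j$ is an edge of the cycle (and adding no other edges). *)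

(* Defs.v *)
From HB Require Import structures.
From mathcomp Require Import all_boot all_order all_algebra.

Set Implicit Arguments.
Unset Strict Implicit.
Unset Printing Implicit Defensive.

Record sgraph := SGraph {
  vertex :> finType;
  adj : rel vertex;
  adj_sym : symmetric adj;
  adj_irr : irreflexive adj
}.
Arguments adj {s} x y.

Definition isomorphic (G H : sgraph) : Prop :=
  exists f : G -> H, bijective f /\ forall x y : G, adj (f x) (f y) = adj x y.

(* [ordS i] is [i + 1] modulo [k]; the first conjunct only matters when
   [k = 1]. For [k >= 3] this is the cycle C_k. *)
Definition cycle_adj (k : nat) : rel 'I_k :=
  fun i j => (i != j) && ((j == ordS i) || (i == ordS j)).

Lemma cycle_adj_sym k : symmetric (@cycle_adj k).
Proof. by move=> i j; rewrite /cycle_adj eq_sym orbC. Qed.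

Lemma cycle_adj_irr k : irreflexive (@cycle_adj k).
Proof. by move=> i; rewrite /cycle_adj eqxx. Qed.

Definition cycle_graph (k : nat) : sgraph :=
  SGraph (@cycle_adj_sym k) (@cycle_adj_irr k).

Definition blowup_adj (H : sgraph) (m : nat) : rel (H * 'I_m)%type :=
  fun u v => adj u.1 v.1.

Lemma blowup_adj_sym (H : sgraph) m : symmetric (@blowup_adj H m).
Proof. by move=> u v; apply: adj_sym. Qed.

Lemma blowup_adj_irr (H : sgraph) m : irreflexive (@blowup_adj H m).
Proof. by move=> u; apply: adj_irr. Qed.

Definition blowup (H : sgraph) (m : nat) : sgraph :=
  SGraph (@blowup_adj_sym H m) (@blowup_adj_irr H m).

Definition is_balanced_cycle_blowup (k : nat) (G : sgraph) : Prop :=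
  k %| #|G| /\ isomorphic G (blowup (cycle_graph k) (#|G| %/ k)).

Definition edges (G : sgraph) : {set {set G}} :=
  [set [set p.1; p.2] | p : G * G & adj p.1 p.2].

(* A candidate subgraph is a pair (vertex set, edge set). *)
Definition is_subgraph (G : sgraph) (S : {set G} * {set {set G}}) : bool :=
  (S.2 \subset edges G) && [forall A in S.2, A \subset S.1].

Definition subgraph_iso (H G : sgraph) (S : {set G} * {set {set G}}) : bool :=
  [exists f : {ffun H -> G},
    [&& injectiveb f, [set f x | x : H] == S.1 &
        [forall x, forall y, adj x y == ([set f x; f y] \in S.2)]]].

Definition copies (H G : sgraph) : {set {set G} * {set {set G}}} :=
  [set S | is_subgraph S & subgraph_iso H S].

Definition no_short_odd_cycle (k : nat) (G : sgraph) : Prop :=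
  forall l : nat, odd l -> 3 <= l -> l < k ->
    copies (cycle_graph l) G = set0.

(* Main.v *)
Require Import Defs.
From HB Require Import structures.
From mathcomp Require Import all_boot all_order all_algebra.
From mathcomp Require Import zify ring lra.

Set Implicit Arguments.
Unset Strict Implicit.
Unset Printing Implicit Defensive.

Import Order.TTheory GRing.Theory Num.Theory.

(* Search for a closed k-walk v vertex by vertex in the order
   v 0, v 1, v 3, v 4, .., v (k - 1), v 2, drawing each vertex uniformly from a
   set of candidates determined by the vertices already found. The probabilities
   of the outcomes sum to at most 1. For a fixed walk, the probability of
   finding it is the inverse product of the sizes of the candidate sets, and by
   AM-GM the average over the k rotations of the walk is at least
   (k / n)^k / (2k), provided that these sizes have a small enough (weighted) sum.
   That is a local count: since all odd closed walks have length at least k,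
   a vertex u has at most two neighbours on the walk, at distance 2 from each
   other, and in each case u is a candidate of weight at most k - 1 in total.
   Hence there are at most 2k (n / k)^k closed k-walks, and every copy of C_k
   yields 2k of them.

   In the case of equality all candidate sets have the size they have in the
   balanced blow-up. Hence the sets of vertices that can replace a given vertex
   of a fixed walk have size n / k and partition the vertices, edges only join
   consecutive classes, and all degrees are 2n / k, so that consecutive classes
   are completely joined. *)

(** * Copies of a graph and odd closed walks *)

(** Turns membership in [copies] into a statement on maps: the copies are exactly the images of
    injective homomorphisms. *)
Definition copy_of (H G : sgraph) (f : H -> G) : {set G} * {set {set G}} :=
  ([set f x | x : H], [set [set f p.1; f p.2] | p : H * H & adj p.1 p.2]).

Lemma set2_inj (T : finType) (a b c d : T) :
  [set a; b] = [set c; d] -> a = c /\ b = d \/ a = d /\ b = c.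
Proof.
move=> e.
have := set21 a b; rewrite e => /set2P[] ea; have := set22 a b;
  rewrite e => /set2P[] eb; subst; auto.
- have := set22 c d; rewrite -e => /set2P[]->; auto.
- have := set21 c d; rewrite -e => /set2P[]->; auto.
Qed.

Lemma copy_of_in_copies (H G : sgraph) (f : H -> G) :
  injective f -> (forall x y, adj x y -> adj (f x) (f y)) ->
  copy_of f \in copies H G.
Proof.
move=> finj fadj; rewrite inE; apply/andP; split.
  apply/andP; split.
    apply/subsetP=> A /imsetP[[x y]]; rewrite inE /= => xy ->.
    by apply/imsetP; exists (f x, f y); rewrite ?inE //=; apply: fadj.
  apply/forall_inP=> A /imsetP[[x y] _ ->] /=.
  by apply/subsetP=> z /set2P[]->; apply: imset_f.
apply/existsP; exists [ffun x => f x]; apply/and3P; split.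
- by apply/injectiveP=> x y; rewrite !ffunE => /finj.
- by apply/eqP/setP=> z; apply/imsetP/imsetP=> -[x _ ->]; exists x; rewrite ?ffunE.
- apply/forallP=> x; apply/forallP=> y; rewrite !ffunE; apply/eqP.
  apply/idP/imsetP => [xy|[[a b]]]; first by exists (x, y); rewrite ?inE.
  rewrite inE /= => ab /set2_inj[[/finj-> /finj->]//|[/finj-> /finj->]].
  by rewrite adj_sym.
Qed.

Lemma copiesP (H G : sgraph) S : S \in copies H G ->
  exists f : {ffun H -> G},
    [/\ injective f, forall x y, adj x y -> adj (f x) (f y) & S = copy_of f].
Proof.
case: S => V A; rewrite inE => /andP[/andP[/= Asub /forall_inP AV]].
case/existsP=> f /and3P[/injectiveP finj /eqP /= eV /forallP fA].
have {}fA x y : adj x y = ([set f x; f y] \in A).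
  by have /forallP/(_ y)/eqP := fA x.
have edgeP B : B \in A -> exists2 p : H * H, adj p.1 p.2 & B = [set f p.1; f p.2].
  move=> BA; have /imsetP[[x y] _ /= eB] := subsetP Asub _ BA.
  have BV := subsetP (AV _ BA); rewrite eB -eV in BV.
  have /imsetP[a _ ea] := BV _ (set21 _ _).
  have /imsetP[b _ eb] := BV _ (set22 _ _).
  by exists (a, b); rewrite /= ?fA -ea -eb // -eB.
exists f; split=> //.
  move=> x y; rewrite fA => xyA; have /imsetP[[a b]] := subsetP Asub _ xyA.
  rewrite inE /= => ab /set2_inj[[-> ->]//|[-> ->]].
  by rewrite adj_sym.
rewrite /copy_of eV; congr pair; apply/setP=> B; apply/idP/imsetP.
  by case/edgeP=> p ap ->; exists p; rewrite ?inE.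
by case=> [[x y]]; rewrite inE /= fA => ? ->.
Qed.

Lemma copy_of_aut (H G : sgraph) (f : H -> G) (s : H -> H) :
  bijective s -> (forall x y, adj (s x) (s y) = adj x y) ->
  copy_of (f \o s) = copy_of f.
Proof.
case=> s' sK s'K sadj; rewrite /copy_of; congr pair; apply/setP=> z.
  apply/imsetP/imsetP=> [[x _ ->]|[x _ ->]]; first by exists (s x).
  by exists (s' x); rewrite //= s'K.
apply/imsetP/imsetP=> -[[x y]]; rewrite inE /= => xy ->.
  by exists (s x, s y); rewrite ?inE //= sadj.
by exists (s' x, s' y); rewrite ?inE /= ?s'K // -sadj !s'K.
Qed.

Section Walks.
Variable G : sgraph.
Implicit Types (x y z u : G) (m : nat).

Fixpoint walk m x y : bool :=
  if m is m'.+1 then [exists z, adj x z && walk m' z y] else x == y.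

Lemma walk_pathP m x y :
  reflect (exists p, [/\ path adj x p, size p = m & last x p = y]) (walk m x y).
Proof.
apply: (iffP idP) => [|[p []]]; last first.
  elim: p x m => [|z p IH] x [|m] //= => [_ _ ->|/andP[xz pz] [sz] lz].
    exact: eqxx.
  by apply/existsP; exists z; rewrite xz IH.
elim: m x => [|m IH] x /= => [/eqP->|]; first by exists [::].
case/existsP=> z /andP[xz /IH[p [pz sz lz]]].
by exists (z :: p); rewrite /= xz sz.
Qed.

Lemma walk1 x y : walk 1 x y = adj x y.
Proof.
apply/existsP/idP => [[z /andP[xz /eqP<-]]//|xy].
by exists y; rewrite xy eqxx.
Qed.

Lemma walk_cat m n x y z : walk m x y -> walk n y z -> walk (m + n) x z.
Proof.
move=> /walk_pathP[p [pp <- <-]] /walk_pathP[q [pq <- <-]].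
by apply/walk_pathP; exists (p ++ q); rewrite cat_path pp pq size_cat last_cat.
Qed.

Lemma walk_sym m x y : walk m x y -> walk m y x.
Proof.
elim: m x => [|m IH] x; first by rewrite /= eq_sym.
case/existsP=> z /andP[xz /IH zy].
by rewrite -addn1; apply: walk_cat zy _; rewrite walk1 adj_sym.
Qed.

Variable k : nat.
Hypothesis noshort : no_short_odd_cycle k G.

(** Strong induction on the length. Without repeated vertices, [c] is a genuine cycle, so [noshort]
    applies. Otherwise it splits at a repeated vertex into two shorter closed walks, one of which is
    odd. *)
Lemma odd_cycle_ge (c : seq G) : cycle adj c -> odd (size c) -> k <= size c.
Proof.
have [n] := ubnP (size c); elim: n c => // n IH c lecn cc oc.
case: (boolP (uniq c)) => [uc|].
  have lt1 : 1 < size c.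
    by case: c cc oc {lecn uc} => [|x [|]] //=; rewrite adj_irr.
  rewrite leqNgt; apply/negP=> ltk.
  have x0 : G by case: c cc oc {lecn uc lt1 ltk}.
  have c_gt0 : 0 < size c by apply: ltnW.
  have adjS (i : 'I_(size c)) : adj (nth x0 c i) (nth x0 c (ordS i)).
    rewrite /=; case: i => i lti /=; case: c cc lti {lecn oc uc lt1 ltk c_gt0} => [//|a c].
    rewrite /cycle => /(pathP x0) ac; rewrite [size (a :: c)]/= => lti.
    have := ac i; rewrite size_rcons => /(_ lti); move: lti.
    rewrite ltnS -rcons_cons nth_rcons /= ltnS => lei; rewrite lei.
    rewrite leq_eqVlt in lei; case/predU1P: lei => [->|lti].
      by rewrite modnn nth_rcons ltnn eqxx.
    by rewrite nth_rcons lti modn_small.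
  pose f (i : cycle_graph (size c)) : G := nth x0 c (val i).
  suff : copy_of f \in copies (cycle_graph (size c)) G.
    by rewrite noshort ?inE //; lia.
  apply: copy_of_in_copies.
    move=> i j /eqP; rewrite nth_uniq ?(ltn_ord (i : 'I__)) ?(ltn_ord (j : 'I__)) //.
    by move/eqP/val_inj.
  move=> i j /= /andP[_ /orP[]/eqP->]; first exact: adjS.
  by rewrite adj_sym; apply: adjS.
have x0 : G by case: c cc oc {lecn}.
case/(uniqPn x0)=> i [j [ltij ltj eij]].
pose a := take i c; pose x := nth x0 c i.
pose b := take (j - i.+1) (drop i.+1 c); pose d := drop j.+1 c.
have ec : c = a ++ x :: b ++ x :: d.
  rewrite -{1}(cat_take_drop i c) (drop_nth x0); last by apply: ltn_trans ltj.
  congr (_ ++ _ :: _); rewrite -{1}(cat_take_drop (j - i.+1) (drop i.+1 c)).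
  by congr (_ ++ _); rewrite drop_drop subnK // (drop_nth x0) // -eij.
(* Rotating [a] to the end leaves two closed walks based at [x], namely [x :: b] and [d']. *)
move: cc oc lecn; rewrite ec cycle_catC -cat_cons -catA.
set d' := (x :: d) ++ a.
have -> : cycle adj ((x :: b) ++ d') = cycle adj (x :: b) && cycle adj d'.
  by rewrite /d' /= rcons_cat cat_path /= [path adj x (rcons b x)]rcons_path andbA.
move=> /andP[cb cd]; rewrite !size_cat /= ?size_cat /= => oc lecn.
have sd : size d' = (size d + size a).+1 by rewrite size_cat.
case ob : (odd (size (x :: b))).
  by apply: leq_trans (IH _ _ cb ob) _ => /=; lia.
have od : odd (size d') by rewrite sd /=; move: oc ob => /=; lia.
by apply: leq_trans (IH _ _ cd od) _; rewrite sd; lia.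
Qed.

(** The form in which the hypothesis on [G] is used from here on: one walk followed by the reverse
    of the other is an odd closed walk. *)
Lemma walk_parity m n x y : walk m x y -> walk n x y -> odd (m + n) -> k <= m + n.
Proof.
move=> wm /walk_sym wn omn; have /walk_pathP[p [pp sp lp]] := walk_cat wm wn.
by rewrite -sp; apply: odd_cycle_ge; rewrite ?sp // (cycle_path x) lp.
Qed.

End Walks.

Arguments walk : simpl never.

(** * Candidates in the search for a closed walk *)

Lemma sum_bool_le (n : nat) (P : pred nat) (l : seq nat) :
  (forall i, i < n -> P i -> i \in l) -> \sum_(0 <= i < n) P i <= size l.
Proof.
move=> Pl; rewrite -[X in X <= _]big_mkcond /= sum1_count -size_filter.
apply: uniq_leq_size => [|i]; first exact/filter_uniq/iota_uniq.
by rewrite mem_filter mem_index_iota => /andP[Pi lti]; apply: Pl.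
Qed.

Lemma sum_periodic (k : nat) (g : nat -> nat) (a : nat) :
  (forall i, g (i + k) = g i) ->
  \sum_(0 <= i < k) g (a + i) = \sum_(0 <= i < k) g i.
Proof.
move=> gk; elim: a => // a <-.
have : \sum_(0 <= i < k) g (a.+1 + i) + g a = \sum_(0 <= i < k) g (a + i) + g a.
  rewrite -[in RHS](gk a) -(big_nat_recr k 0 (fun i => g (a + i))) //=.
  rewrite big_nat_recl //= addn0 addnC; congr addn.
  by apply: eq_bigr => i _; rewrite addSnnS.
by move/addIn.
Qed.

Section Counting.
Variables (G : sgraph) (k : nat).
Hypotheses (k_odd : odd k) (k_ge7 : 7 <= k) (noshort : no_short_odd_cycle k G).

(* Steps are numbered in the search order v 0, v 1, v 3, v 4, .., v (k - 1), v 2: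
   step [t] finds [v t.+1] for [2 <= t < k.-1], and [v 2] for [t = k.-1]. *)
Definition cand (v : nat -> G) (t : nat) (u : G) : bool :=
  if t == 0 then true
  else if t == 1 then adj (v 0) u
  else if t == 2 then walk 2 (v 1) u && ~~ adj (v 0) u
  else if t == k.-1 then adj (v 1) u && adj (v 3) u
  else adj (v t) u && walk (k - t.+1) u (v 0).

(** Indexed periodically by all naturals, so that a rotation is a mere translation of the index. *)
Definition closed_walk (v : nat -> G) : Prop :=
  (forall i, v (i + k) = v i) /\ (forall i, adj (v i) (v i.+1)).

Definition shift (a : nat) (v : nat -> G) : nat -> G := fun i => v (a + i).

(* Weights are doubled: the first step counts half, since in the blow-up
   it has 2n / k candidates, and all later steps have n / k. *)
Definition load (v : nat -> G) (u : G) : nat :=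
  \sum_(1 <= t < k) (if t == 1 then 1 else 2) * \sum_(0 <= s < k) cand (shift s v) t u.

Lemma cand_last v u : cand v k.-1 u = adj (v 1) u && adj (v 3) u.
Proof. by rewrite /cand eqxx !ifF //; move: k_ge7; clear; lia. Qed.

Lemma cand_mid v t u : 2 < t < k.-1 ->
  cand v t u = adj (v t) u && walk (k - t.+1) u (v 0).
Proof. by move=> lt; rewrite /cand !ifF //; lia. Qed.

Lemma cand_ext v w t u : v =1 w -> cand v t u = cand w t u.
Proof. by move=> e; rewrite /cand !e. Qed.

Lemma closed_walk_shift a v : closed_walk v -> closed_walk (shift a v).
Proof.
by case=> pv av; split=> i; rewrite /shift ?addnA ?pv // addnS.
Qed.

Lemma load_shift a v u : closed_walk v -> load (shift a v) u = load v u.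
Proof.
case=> pv _; apply: eq_bigr => t _; congr (_ * _).
rewrite -[RHS](sum_periodic a).
  by apply: eq_bigr => s _; congr nat_of_bool; apply: cand_ext => i; rewrite /shift addnA.
by move=> s; congr nat_of_bool; apply: cand_ext => i; rewrite /shift addnAC pv.
Qed.

Lemma loadE v u : load v u =
  \sum_(0 <= s < k) adj (v s) u + 2 * \sum_(2 <= t < k) \sum_(0 <= s < k) cand (shift s v) t u.
Proof.
rewrite /load big_ltn; last lia.
rewrite mul1n; congr addn.
  by apply: eq_bigr => s _; rewrite /cand /shift addn0.
rewrite big_distrr /=; apply: eq_big_nat => t lt.
by rewrite ifF //; lia.
Qed.

Section ClosedWalk.
Variable v : nat -> G.
Hypothesis cv : closed_walk v.
Let pv : forall i, v (i + k) = v i := proj1 cv.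

Lemma v_mod i : v (i %% k) = v i.
Proof.
rewrite [in RHS](divn_eq i k); elim: (i %/ k) => [|q IH]; first by rewrite mul0n.
by rewrite mulSn -addnA addnC pv.
Qed.

Lemma walk_along i m : walk m (v i) (v (i + m)).
Proof.
elim: m => [|m IH]; first by rewrite addn0 /walk.
rewrite addnS -addn1; apply: walk_cat IH _; rewrite walk1; exact: (proj2 cv).
Qed.

Lemma walk_fwd i j : i <= j -> walk (j - i) (v i) (v j).
Proof. by move=> le; rewrite -{2}(subnKC le); apply: walk_along. Qed.

Lemma walk_bwd i j : i <= j <= i + k -> walk (k - (j - i)) (v i) (v j).
Proof.
case/andP=> le1 le2; apply: walk_sym; rewrite -(pv i).
have -> : k - (j - i) = i + k - j by lia.
exact: walk_fwd.
Qed.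

Lemma adj_walk_fwd i j u : adj (v i) u -> i <= j -> walk (j - i).+1 u (v j).
Proof.
move=> iu le; rewrite -add1n; apply: walk_cat (walk_fwd le).
by rewrite walk1 adj_sym.
Qed.

Lemma adj_walk_bwd i j u :
  adj (v i) u -> i <= j <= i + k -> walk (k - (j - i)).+1 u (v j).
Proof.
move=> iu le; rewrite -add1n; apply: walk_cat (walk_bwd le).
by rewrite walk1 adj_sym.
Qed.

(** The two arcs between [v i] and [v j], closed up through [u], have lengths [j - i + 2] and
    [k - (j - i) + 2]. Exactly one of these is odd, and it must be at least [k]. *)
Lemma nbr_dist i j u : adj (v i) u -> adj (v j) u -> i < j < i + k ->
  j = i + 2 \/ j = i + k - 2.
Proof.
move=> iu ju lt; have uj : walk 1 u (v j) by rewrite walk1 adj_sym.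
case oj : (odd (j - i)).
  have := walk_parity noshort (adj_walk_fwd iu _) uj; lia.
have := walk_parity noshort (adj_walk_bwd iu _) uj; lia.
Qed.

(** Every closed walk is a possible outcome of the search. *)
Lemma closed_walk_cand t : t < k ->
  cand v t (v (if t < 2 then t else if t < k.-1 then t.+1 else 2)).
Proof.
move=> ltk; rewrite /cand; case: t ltk => [//|[|t]] ltk /=; first exact: (proj2 cv).
have vk : v k = v 0 by rewrite -{1}(add0n k) pv.
case: eqP => [[->]|t2].
  rewrite ifT; last lia.
  (* An edge from [v 0] to [v 3] would close the rest of the walk to odd length [k - 2]. *)
  apply/andP; split; [exact: (walk_along 1 2) | apply/negP => v03].
  have w1 : walk 1 (v 3) (v 0) by rewrite walk1 adj_sym.
  have := walk_along 3 (k - 3); rewrite subnKC ?vk; last lia.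
  by move=> w2; have := walk_parity noshort w1 w2; lia.
case: eqP => tk.
  by rewrite tk ltnn (proj2 cv) adj_sym (proj2 cv).
rewrite ifT; last lia.
by rewrite (proj2 cv) -vk -(subnKC ltk) addKn walk_along.
Qed.

(** Such a [u] can stand in for [v 1]. It is a candidate for two rotations at step 1 and for at most
    one at each of the [k - 2] later steps, which gives [2 + 2 * (k - 2)]. *)
Lemma load_two u : adj (v 0) u -> adj (v 2) u -> load v u <= 2 * k.-1.
Proof.
move=> u0 u2.
have only i : adj (v i) u -> i < k.*2 -> i \in [:: 0; 2; k; k + 2].
  move=> ui ltik; have [->//|i0] := eqVneq i 0.
  have lt2 j : 0 < j < k -> adj (v j) u -> j = 2.
    move=> ltj uj; have [->//|j2] := eqVneq j 2.
    have := nbr_dist u0 uj; have := nbr_dist u2 uj.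
    have := @nbr_dist j 2 u uj u2; lia.
  have [lt|] := ltnP i k; first by rewrite (lt2 i) ?inE ?orbT //; lia.
  move=> le; have [->|ik] := eqVneq i k; first by rewrite !inE eqxx !orbT.
  have : i - k = 2 by apply: lt2; [lia | rewrite -pv subnK].
  by move=> e; have -> : i = k + 2 by [lia]; rewrite !inE eqxx !orbT.
have B t : 1 < t < k -> \sum_(0 <= s < k) cand (shift s v) t u <= 1.
  move=> ltt; have [e2|nt2] := eqVneq t 2.
    rewrite e2; apply: (@sum_bool_le _ _ [:: k - 2]) => s lts.
    rewrite /cand /shift /= addn0 addn1 => /andP[/walk_sym w2 n0].
    rewrite inE; apply/eqP.
    (* The rotations 0 and 2 are excluded only by the non-adjacency required at step 2. *)
    have s0 : s <> 0 by move=> e; rewrite e u0 in n0.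
    have s2 : s <> 2 by move=> e; rewrite e u2 in n0.
    case os : (odd s).
      have := walk_parity noshort (adj_walk_fwd u2 (_ : 2 <= s.+1)) w2; lia.
    have := walk_parity noshort (adj_walk_bwd u0 (_ : 0 <= s.+1 <= 0 + k)) w2; lia.
  have [ek|ntk] := eqVneq t k.-1.
    apply: (@sum_bool_le _ _ [:: k.-1]) => s lts.
    rewrite ek cand_last /shift.
    by move=> /andP[/only + /only +]; rewrite !inE; lia.
  apply: (@sum_bool_le _ _ [:: k - t]) => s lts.
  rewrite cand_mid /shift ?addn0; last lia.
  case/andP=> /only; rewrite !inE => st w.
  (* The other possibility, [s + t = k + 2], would give a closed walk of length [k - 2] through
     [u]. *)
  have := walk_parity noshort (adj_walk_bwd u0 (_ : 0 <= s <= 0 + k)) w; lia.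
rewrite loadE -[k.-1](@subnKC 1) ?mulnDr; last lia.
apply: leq_add.
  by apply: (@sum_bool_le _ _ [:: 0; 2]) => s lts /only; rewrite !inE; lia.
rewrite leq_mul2l /= -subn1 -subnDA addn1 -(muln1 (k - 2)) -sum_nat_const_nat.
by rewrite big_nat [X in _ <= X]big_nat; apply: leq_sum => t /B.
Qed.

(** Step 2 may now count three rotations, but the last two steps count none. The total is at most
    [1 + 2 * (3 + (k - 5))]. *)
Lemma load_one u : adj (v 0) u -> ~~ adj (v 2) u -> ~~ adj (v (k - 2)) u ->
  load v u <= 2 * k.-1.
Proof.
move=> u0 n2 nk2.
have only i : adj (v i) u -> i < k.*2 -> i \in [:: 0; k].
  move=> ui ltik; have [->//|i0] := eqVneq i 0.
  have lt2 j : 0 < j < k -> ~ adj (v j) u.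
    move=> ltj uj; have [] := nbr_dist u0 uj ltj; rewrite add0n => e.
      by rewrite -e uj in n2.
    by rewrite -e uj in nk2.
  have [lt|] := ltnP i k; first by case: (lt2 i) => //; lia.
  move=> le; have [->|ik] := eqVneq i k; first by rewrite !inE eqxx !orbT.
  by case: (lt2 (i - k)); [lia | rewrite -pv subnK].
have B2 : \sum_(0 <= s < k) cand (shift s v) 2 u <= 3.
  apply: (@sum_bool_le _ _ [:: 2; k - 4; k - 2]) => s lts.
  rewrite /cand /shift /= addn0 addn1 => /andP[/walk_sym w2 n0].
  have s0 : s <> 0 by move=> e; rewrite e u0 in n0.
  rewrite !inE; case os : (odd s).
    have := walk_parity noshort (adj_walk_fwd u0 (_ : 0 <= s.+1)) w2; lia.
  have := walk_parity noshort (adj_walk_bwd u0 (_ : 0 <= s.+1 <= 0 + k)) w2; lia.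
have B t : 2 < t < k -> \sum_(0 <= s < k) cand (shift s v) t u <= (t < k - 2).
  move=> ltt; have [ek|ntk] := eqVneq t k.-1.
    apply: leq_trans (leq0n _); apply: (@sum_bool_le _ _ [::]) => s lts.
    rewrite ek cand_last /shift.
    by move=> /andP[/only + /only +]; rewrite !inE; lia.
  case: ltnP => ltk2; [apply: (@sum_bool_le _ _ [:: k - t])|apply: (@sum_bool_le _ _ [::])];
    move=> s lts; rewrite cand_mid /shift ?addn0; try lia.
    by case/andP=> /only; rewrite !inE; lia.
  case/andP=> /only; rewrite !inE => st.
  (* At step [k - 2] the required walk from [u] has length 1, so it would be an edge to [v 2]. *)
  have -> : s = 2 by lia.
  have -> : k - t.+1 = 1 by lia.
  by rewrite walk1 adj_sym (negPf n2).
rewrite loadE [X in 2 * X]big_ltn; last lia.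
have A : \sum_(0 <= s < k) adj (v s) u <= 1.
  by apply: (@sum_bool_le _ _ [:: 0]) => s lts /only; rewrite !inE; lia.
have C : \sum_(3 <= t < k) \sum_(0 <= s < k) cand (shift s v) t u <= k - 5.
  have {}B : \sum_(3 <= t < k) \sum_(0 <= s < k) cand (shift s v) t u
      <= \sum_(3 <= t < k) (t < k - 2).
    by rewrite big_nat [X in _ <= X]big_nat; apply: leq_sum => t /B.
  apply: leq_trans B _.
  rewrite (@big_cat_nat _ _ _ (k - 2)) /=; try lia.
  rewrite [X in _ + X]big1_seq ?addn0; last first.
    by move=> t /andP[_]; rewrite mem_index_iota; case: ltnP => //; lia.
  apply: leq_trans (_ : \sum_(3 <= t < k - 2) 1 <= _); last by rewrite sum_nat_const_nat; lia.
  by apply: leq_sum => t _; case: (_ < _).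
by apply: leq_trans (leq_add A (leq_mul (leqnn 2) (leq_add B2 C))) _; lia.
Qed.

(** Only step 2 can count [u], and it misses at least two rotations. *)
Lemma load_none u : (forall i, i < k -> ~~ adj (v i) u) -> load v u <= 2 * k.-1.
Proof.
move=> none0; have none i : adj (v i) u = false.
  by rewrite -(v_mod i); apply/negbTE/none0/ltn_pmod; lia.
have A : \sum_(0 <= s < k) adj (v s) u = 0 by apply: big1 => s _; rewrite none.
have C : \sum_(3 <= t < k) \sum_(0 <= s < k) cand (shift s v) t u = 0.
  apply: big1_seq => t /andP[_]; rewrite mem_index_iota => ltt; apply: big1 => s _.
  have [->|ntk] := eqVneq t k.-1; first by rewrite cand_last /shift none.
  by rewrite cand_mid /shift ?none //; lia.
rewrite loadE [X in 2 * X]big_ltn; last lia.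
rewrite A C addn0 add0n leq_mul2l /=.
(* Walks of length 2 to [u] from two consecutive vertices would form a closed walk of length 5. *)
have two j : ~~ (walk 2 (v j) u && walk 2 (v j.+1) u).
  apply/negP=> /andP[w1 w2]; have w3 := walk_cat (walk_along j 1) (_ : walk 2 (v (j + 1)) u).
  by have := walk_parity noshort w1 (w3 _); rewrite addn1 => /(_ w2); lia.
have [a [ea na]] : exists a, a \in [:: 0; 1] /\ ~~ cand (shift a v) 2 u.
  have := two 1; rewrite negb_and => /orP[] n; [exists 0|exists 1];
    by rewrite /cand /shift /= negb_and n.
have [b [eb nb]] : exists b, b \in [:: 2; 3] /\ ~~ cand (shift b v) 2 u.
  have := two 3; rewrite negb_and => /orP[] n; [exists 2|exists 3];
    by rewrite /cand /shift /= negb_and n.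
have := @sum_bool_le k (fun s => cand (shift s v) 2 u) (rem b (rem a (iota 0 k))).
have ha : a \in iota 0 k by rewrite mem_iota; move: ea; rewrite !inE; lia.
have hb : b \in rem a (iota 0 k).
  by rewrite mem_rem_uniq ?iota_uniq // inE mem_iota; move: ea eb; rewrite !inE /=; lia.
rewrite !size_rem // size_iota.
move=> H; apply: leq_trans (H _) _; last lia.
move=> i ltik ci; rewrite mem_rem_uniq ?rem_uniq ?iota_uniq // inE.
rewrite mem_rem_uniq ?iota_uniq // inE mem_iota ltik /= andbT.
by apply/andP; split; [move: nb|move: na]; apply: contraNneq => <-.
Qed.

End ClosedWalk.

(** Rotate so that a neighbour of [u], if there is one, becomes [v 0]. If a second one lies two
    places behind rather than ahead, rotate once more to start there. *)
Lemma load_le v u : closed_walk v -> load v u <= 2 * k.-1.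
Proof.
move=> cv.
have [/existsP[a au]|/existsPn none] := boolP [exists a : 'I_k, adj (v a) u]; last first.
  by apply: load_none => // i lti; apply: (none (Ordinal lti)).
have cw := closed_walk_shift a cv; rewrite -(load_shift a) //.
have w0 : adj (shift a v 0) u by rewrite /shift addn0.
have [w2|n2] := boolP (adj (shift a v 2) u); first exact: load_two.
have [wk|nk] := boolP (adj (shift a v (k - 2)) u); last exact: load_one.
rewrite -(load_shift (k - 2)) //; apply: load_two.
- exact: closed_walk_shift.
- by rewrite {1}/shift addn0.
- rewrite {1}/shift subnK; last lia.
  by have := proj1 cw 0; rewrite add0n => ->.
Qed.

End Counting.

(** * The number of closed walks *)

Section SearchTree.
Local Open Scope ring_scope.
Variable T : finType.

(** [C] maps the vertices drawn so far to the set for the next draw. An empty set contributes 0, so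
    the probabilities may sum to less than 1. *)
Fixpoint search_prob (C : seq T -> {set T}) (s : seq T) : rat :=
  if s is x :: s' then
    (x \in C [::])%:R / #|C [::]|%:R * search_prob (fun p => C (x :: p)) s'
  else 1.

Lemma search_prob_ge0 C s : 0 <= search_prob C s.
Proof.
by elim: s C => //= x s IH C; rewrite mulr_ge0 ?divr_ge0 ?ler0n.
Qed.

Lemma sum_search_prob_le1 m C : \sum_(t : m.-tuple T) search_prob C t <= 1.
Proof.
elim: m C => [|m IH] C.
  rewrite (eq_bigr (fun=> 1)) => [|t _]; last by rewrite (tuple0 t).
  by rewrite sumr_const card_tuple expn0.
rewrite (reindex (fun p : T * m.-tuple T => cons_tuple p.1 p.2)) /=; last first.
  exists (fun t => (thead t, behead_tuple t)) => [[x t] _|t _].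
    by congr pair; apply: val_inj.
  by rewrite [t in RHS]tuple_eta; apply: val_inj.
rewrite -(pair_bigA _ (fun x (t : m.-tuple T) =>
  (x \in C [::])%:R / #|C [::]|%:R * search_prob (fun p => C (x :: p)) t)) /=.
apply: (@le_trans _ _ (\sum_x (x \in C [::])%:R / #|C [::]|%:R)).
  apply: ler_sum => x _; rewrite -mulr_sumr ler_piMr ?IH // divr_ge0 ?ler0n //.
rewrite -mulr_suml -natr_sum -big_mkcond sum1_card /=.
have [->|C0] := eqVneq #|C [::]| 0%N; first by rewrite mul0r.
by rewrite divff ?pnatr_eq0.
Qed.

Lemma search_prob_prod (C : seq T -> {set T}) x0 s : (forall i, (i < size s)%N -> nth x0 s i \in C (take i s)) ->
  search_prob C s = \prod_(0 <= i < size s) #|C (take i s)|%:R^-1.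
Proof.
elim: s C => [|x s IH] C Cs /=; first by rewrite big_nil.
rewrite big_nat_recl //= -(IH (fun p => C (x :: p))) => [|i lti]; last exact: (Cs i.+1).
by rewrite (Cs 0%N) // mul1r.
Qed.

End SearchTree.

(** * AM-GM for numbers completed to product 1 *)

Section AGM.
Local Open Scope ring_scope.

Lemma agm_inv (m : nat) (a : nat -> rat) : (forall t, (0 < t < m)%N -> 0 < a t) -> (0 < m)%N ->
  m%:R <= (\prod_(1 <= t < m) a t)^-1 + \sum_(1 <= t < m) a t
    /\ (m%:R = (\prod_(1 <= t < m) a t)^-1 + \sum_(1 <= t < m) a t ->
        forall t, (0 < t < m)%N -> a t = 1).
Proof.
move=> a_gt0 m_gt0; set P := \prod_(1 <= t < m) a t.
have P_gt0 : 0 < P.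
  by rewrite /P big_nat; apply: prodr_gt0 => t lt; apply: a_gt0.
(* Placing the inverse product at index 0 gives [m] numbers with product 1. Their mean is thus at
   least 1, and if it is 1, they are all equal to 1. *)
pose b t := if t is 0%N then P^-1 else a t.
have b_gt0 (i : 'I_m) : 0 < b i.
  by case: i => [[|i] lti] /=; rewrite ?invr_gt0 // a_gt0.
have sumE : \sum_(i < m) b i = P^-1 + \sum_(1 <= t < m) a t.
  rewrite -(big_mkord predT b) big_ltn //; congr (_ + _).
  by apply: eq_big_nat => -[].
have prodE : \prod_(i < m) b i = 1.
  rewrite -(big_mkord predT b) big_ltn // (eq_big_nat _ _ (F2 := a)); last by case.
  by rewrite mulVf // gt_eqF.
have m0 : 0 < m%:R :> rat by rewrite ltr0n.
have [|le1 eq1] := @leif_AGM rat 'I_m predT b.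
  by move=> i _; apply: ltW.
move: le1 eq1; rewrite sumE prodE cardT size_enum_ord => le1 eq1.
set S := P^-1 + _ in le1 eq1 *.
have S_ge0 : 0 <= S by rewrite /S -sumE; apply: sumr_ge0 => i _; apply: ltW.
have le : m%:R <= S.
  rewrite -[m%:R]mul1r -ler_pdivlMr //.
  by rewrite -(@ler_pXn2r _ m) ?expr1n // nnegrE ?divr_ge0 // ltW.
split=> // eS t ltt.
have alleq : [forall i in 'I_m, forall j in 'I_m, b i == b j].
  by rewrite -eq1 -eS divff ?expr1n // lt0r_neq0.
have tm : (t < m)%N by case/andP: ltt.
have bt : b t = 1.
  have : S = b t *+ m.
    transitivity (\sum_(i < m) b t); last by rewrite sumr_const card_ord.
    rewrite /S -sumE; apply: eq_bigr => i _.
    by have /forall_inP/(_ i isT)/forall_inP/(_ (Ordinal tm) isT)/eqP := alleq.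
  by rewrite -eS -[RHS]mulr_natl -[LHS]mulr1 => /(mulfI (lt0r_neq0 m0)).
by case: t ltt bt {tm}.
Qed.
End AGM.

(** * Search probabilities of closed walks, averaged over rotations *)

Section Bound.
Variables (G : sgraph) (k : nat).
Hypotheses (k_odd : odd k) (k_ge7 : 7 <= k) (noshort : no_short_odd_cycle k G).

Let k_gt0 : 0 < k. Proof. exact: leq_trans k_ge7. Qed.

Definition unroll (f : {ffun 'I_k -> G}) (i : nat) : G := f (Ordinal (ltn_pmod i k_gt0)).

Definition closed_walks : {set {ffun 'I_k -> G}} :=
  [set f : {ffun 'I_k -> G} | [forall i, adj (f i) (f (ordS i))]].

Definition rotate (s : nat) (f : {ffun 'I_k -> G}) : {ffun 'I_k -> G} :=
  [ffun i : 'I_k => unroll f (s + i)].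

Lemma unroll_ord f (i : 'I_k) : unroll f i = f i.
Proof. by congr (f _); apply: val_inj; rewrite /= modn_small. Qed.

Lemma unroll_mod f i j : i = j %[mod k] -> unroll f i = unroll f j.
Proof. by move=> e; congr (f _); apply: val_inj. Qed.

Lemma closed_walksP f : reflect (closed_walk k (unroll f)) (f \in closed_walks).
Proof.
rewrite inE; apply: (iffP forallP) => [fa|[_ fa] i].
  split=> i; first by apply: unroll_mod; rewrite modnDr.
  have := fa (Ordinal (ltn_pmod i k_gt0)); congr (adj _ (f _)).
  by apply: val_inj; rewrite /= -addn1 modnDml addn1.
have := fa i; rewrite unroll_ord; congr (adj _ (f _)); exact: val_inj.
Qed.

Lemma unroll_rotate s f : unroll (rotate s f) =1 shift s (unroll f).
Proof.
by move=> i; rewrite {1}/unroll ffunE /=; apply: unroll_mod; rewrite modnDmr.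
Qed.

Lemma rotate_closed s f : f \in closed_walks -> rotate s f \in closed_walks.
Proof.
move/closed_walksP/(closed_walk_shift s) => [pv av]; apply/closed_walksP.
by split=> i; rewrite !unroll_rotate.
Qed.

Lemma rotateK s t : k %| s + t -> cancel (rotate s) (rotate t).
Proof.
move=> dst f; apply/ffunP=> i; rewrite ffunE unroll_rotate /shift addnA.
rewrite -[RHS]unroll_ord; apply: unroll_mod.
by rewrite -modnDml (eqP dst) add0n.
Qed.

Definition candidates (f : {ffun 'I_k -> G}) (t : nat) : {set G} :=
  [set u | cand k (unroll f) t u].

(** Double counting: each vertex [u] contributes its [load]. *)
Lemma sum_candidates f : f \in closed_walks ->
  \sum_(0 <= s < k) \sum_(1 <= t < k) (if t == 1 then 1 else 2) * #|candidates (rotate s f) t|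
    <= k.-1.*2 * #|G|.
Proof.
move/closed_walksP=> cf; rewrite exchange_big /=.
apply: leq_trans (_ : \sum_(u : G) load k (unroll f) u <= _); last first.
  rewrite mulnC -sum_nat_const; apply: leq_sum => u _.
  by rewrite -mul2n load_le.
rewrite /load [leqRHS]exchange_big /=; apply: leq_sum => t _.
rewrite -!big_distrr /= leq_mul2l; apply/orP; right; rewrite [leqRHS]exchange_big /=.
apply: leq_sum => s _; rewrite -sum1_card big_mkcond /=.
by apply: leq_sum => u _; rewrite inE (cand_ext _ _ _ (unroll_rotate s f)); case: cand.
Qed.

(* Inverse of the search order: v i is chosen at step [search_step i]. *)
Definition search_step (i : nat) : nat :=
  if i < 2 then i else if i == 2 then k.-1 else i.-1.

Definition search_seq (f : {ffun 'I_k -> G}) : seq G :=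
  mkseq (fun t => unroll f (if t < 2 then t else if t < k.-1 then t.+1 else 2)) k.

Lemma nth_search_seq x0 f i : i < k -> nth x0 (search_seq f) (search_step i) = unroll f i.
Proof.
move=> ltik; rewrite nth_mkseq /search_step.
  by congr unroll; repeat case: ifP; lia.
by repeat case: ifP; lia.
Qed.

(** Positions of the walk not yet found read the default [x0]. By [search_setE], no step of the
    search consults them. *)
Definition search_set (x0 : G) (p : seq G) : {set G} :=
  [set u | cand k (fun i => nth x0 p (search_step i)) (size p) u].

Lemma search_setE x0 f t : t < k -> search_set x0 (take t (search_seq f)) = candidates f t.
Proof.
move=> ltt; apply/setP=> u; rewrite !inE size_takel ?size_mkseq; last exact: ltnW.
have E i : search_step i < t -> i < k ->
    nth x0 (take t (search_seq f)) (search_step i) = unroll f i.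
  by move=> lti ltik; rewrite nth_take // nth_search_seq.
rewrite /cand; case: ifP => // t0; case: ifP => [/eqP t1|t1].
  by rewrite !E // /search_step /=; lia.
case: ifP => [/eqP t2|t2]; first by rewrite !E // /search_step /=; lia.
case: ifP => [/eqP t3|t3]; first by rewrite !E // /search_step /=; lia.
have e : search_step t = t.-1 by rewrite /search_step !ifF //; lia.
have e0 : search_step 0 < t by rewrite /search_step /=; lia.
by rewrite (E 0) // (E t) // e; lia.
Qed.

Lemma search_seq_inj : injective search_seq.
Proof.
move=> f g e; apply/ffunP=> i; have x0 := f i.
by rewrite -!unroll_ord -!(nth_search_seq x0) // e.
Qed.

Local Open Scope ring_scope.

Definition candidate_prod f : rat := \prod_(0 <= t < k) #|candidates f t|%:R^-1.

(** Each summand is the probability that the search finds [f], and distinct walks are distinct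
    outcomes. *)
Lemma sum_candidate_prod : \sum_(f in closed_walks) candidate_prod f <= 1.
Proof.
have [->|[f0 _]] := set_0Vmem closed_walks; first by rewrite big_set0.
have x0 : G := unroll f0 0.
have sz f : size (search_seq f) == k by rewrite size_mkseq.
pose h f : k.-tuple G := Tuple (sz f).
have hinj : injective h by move=> f g [/search_seq_inj].
apply: le_trans (sum_search_prob_le1 k (search_set x0)).
rewrite [leRHS](bigID (mem (h @: closed_walks))) /= -[leLHS]addr0 lerD //; last first.
  by apply: sumr_ge0 => t _; apply: search_prob_ge0.
rewrite big_imset /=; last by move=> ? ? _ _; apply: hinj.
apply: ler_sum => f fw; rewrite (@search_prob_prod _ _ x0); last first.
  rewrite size_mkseq => i lti; rewrite search_setE // inE nth_mkseq //.
  by apply: closed_walk_cand => //; apply/closed_walksP.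
rewrite size_mkseq /candidate_prod big_nat [leRHS]big_nat.
by under [leRHS]eq_bigr => t lt do rewrite search_setE //.
Qed.

Section Nonempty.
Hypothesis G_gt0 : (0 < #|G|)%N.

Let c : rat := k%:R / #|G|%:R.

(** Normalised to equal 1 at every step [0 < t < k] when the candidate sets have their blow-up
    sizes: [2n / k] at step 1 and [n / k] later. *)
Definition cand_ratio f t : rat :=
  c / 2 * ((if t == 1 then 1 else 2) * #|candidates f t|)%N%:R.

Let n_gt0 : 0 < #|G|%:R :> rat. Proof. by rewrite ltr0n. Qed.
Let kr_gt0 : 0 < k%:R :> rat. Proof. by rewrite ltr0n. Qed.
Let c_gt0 : 0 < c. Proof. exact: divr_gt0. Qed.

Lemma candidates_gt0 f t : f \in closed_walks -> (t < k)%N -> (0 < #|candidates f t|)%N.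
Proof.
move/closed_walksP=> cf ltk; apply/card_gt0P.
by eexists; rewrite inE; apply: closed_walk_cand.
Qed.

Lemma cand_ratio_gt0 f t : f \in closed_walks -> (t < k)%N -> 0 < cand_ratio f t.
Proof.
move=> fw ltk; rewrite mulr_gt0 ?divr_gt0 // ltr0n muln_gt0 candidates_gt0 // andbT.
by case: ifP.
Qed.

(** The factor 2 remains because step 1 has weight 1; the factor [k] is [c] times the [#|G|]
    candidates of step 0. *)
Lemma prod_cand_ratio f : (\prod_(1 <= t < k) cand_ratio f t)^-1 =
  2 * k%:R * c ^- k * candidate_prod f.
Proof.
have wts : \prod_(1 <= t < k) (if t == 1 then 1 else 2)%N%:R = 2 ^+ (k - 2) :> rat.
  rewrite big_ltn ?mul1r; last lia.
  by rewrite -prodr_const_nat; apply: eq_big_nat => t lt; rewrite ifF //; lia.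
rewrite /candidate_prod /cand_ratio [in RHS]big_ltn // big_split /=.
under [X in _ * X]eq_bigr => t _ do rewrite natrM.
rewrite prodr_const_nat big_split /= wts.
have -> : candidates f 0 = setT by apply/setP=> u; rewrite !inE.
rewrite cardsT prodfV exprMn.
have -> : (k - 1 = (k - 2).+1)%N by lia.
set P := \prod_(1 <= t < k) _.
have -> : c ^- k = c ^- (k - 2).+1 * c^-1 by rewrite -invfM -exprSr; congr (_ ^- _); lia.
rewrite !invfM !invrK exprVn exprS invfM.
have -> : c^-1 = #|G|%:R / k%:R by rewrite /c invf_div.
have e2 : (2 : rat) ^+ (k - 2) != 0 by rewrite expf_neq0.
have ec : c ^+ (k - 2) != 0 by rewrite expf_neq0 // gt_eqF.
rewrite [2 ^+ _.+1]exprS.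
move: e2 ec n_gt0 kr_gt0; set x := 2 ^+ (k - 2); set y := c ^+ _; set p := P^-1.
move=> e2 ec n0 k0; field.
by rewrite e2 ec !gt_eqF.
Qed.

(** Rotation permutes the closed walks, so each summand may be averaged over the [k] rotations of
    its walk, where [sum_candidates] applies. *)
Lemma sum_cand_ratio : \sum_(f in closed_walks) \sum_(1 <= t < k) cand_ratio f t
  <= #|closed_walks|%:R * k.-1%:R.
Proof.
rewrite -(ler_pM2l kr_gt0).
have -> : k%:R * \sum_(f in closed_walks) \sum_(1 <= t < k) cand_ratio f t =
    \sum_(f in closed_walks) \sum_(0 <= s < k) \sum_(1 <= t < k) cand_ratio (rotate s f) t.
  rewrite [RHS]exchange_big /= mulr_natl.
  transitivity (\sum_(0 <= s < k) \sum_(f in closed_walks) \sum_(1 <= t < k) cand_ratio f t).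
    by rewrite sumr_const_nat subn0.
  apply: eq_big_nat => s lts; rewrite (reindex (rotate s)) /=.
    apply: eq_bigl => f; apply/idP/idP; last exact: rotate_closed.
    move/(rotate_closed (k - s)); rewrite rotateK // subnKC //; lia.
  have d : (k %| s + (k - s))%N by rewrite subnKC //; lia.
  by exists (rotate (k - s)) => f _; apply: rotateK; rewrite // addnC.
rewrite mulrCA mulr_natl -sumr_const; apply: ler_sum => f fw.
under eq_bigr => s _ do rewrite -mulr_sumr -natr_sum.
rewrite -mulr_sumr -natr_sum.
apply: le_trans (_ : c / 2 * (k.-1.*2 * #|G|)%:R <= _).
  by rewrite ler_pM2l ?divr_gt0 // ler_nat sum_candidates.
rewrite -mul2n !natrM le_eqVlt; apply/orP; left; apply/eqP; rewrite /c.
by field; rewrite gt_eqF.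
Qed.

Lemma card_closed_walks : #|closed_walks|%:R <= 2 * k%:R * (#|G|%:R / k%:R) ^+ k :> rat
  /\ (2 * k%:R * (#|G|%:R / k%:R) ^+ k <= #|closed_walks|%:R :> rat ->
      forall f t, f \in closed_walks -> (0 < t < k)%N -> cand_ratio f t = 1).
Proof.
(* The slack of AM-GM for [f]. It is nonnegative, and its sum is at most the gap in the bound, so
   equality makes every slack vanish. *)
pose d f := (\prod_(1 <= t < k) cand_ratio f t)^-1 + \sum_(1 <= t < k) cand_ratio f t - k%:R.
have agm f : f \in closed_walks ->
    0 <= d f /\ (d f = 0 -> forall t, (0 < t < k)%N -> cand_ratio f t = 1).
  move=> fw; have [|le eq] := @agm_inv k (cand_ratio f) _ k_gt0.
    by move=> t /andP[_ lt]; apply: cand_ratio_gt0.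
  by rewrite subr_ge0; split=> // /subr0_eq/esym.
have sumd : #|closed_walks|%:R + \sum_(f in closed_walks) d f <=
    2 * k%:R * (#|G|%:R / k%:R) ^+ k.
  rewrite /d sumrB big_split /= sumr_const.
  under [X in _ + (X + _ - _)]eq_bigr => f _ do rewrite prod_cand_ratio.
  rewrite -mulr_sumr.
  have := sum_cand_ratio; have := sum_candidate_prod.
  have -> : k.-1%:R = k%:R - 1 :> rat by rewrite -subn1 natrB.
  rewrite -exprVn /c invf_div -mulr_natr.
  set A := 2 * k%:R * _; set B := \sum_(_ in _) candidate_prod _; set C := \sum_(_ in _) _.
  set N := #|_|%:R; move=> B1 C1.
  have A0 : 0 <= A by rewrite mulr_ge0 ?exprn_ge0 ?divr_ge0 // mulr_ge0 // ltW.
  have : A * B <= A by rewrite ler_piMr.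
  lra.
have d0 : 0 <= \sum_(f in closed_walks) d f.
  by apply: sumr_ge0 => f /agm[].
split=> [|le f t fw lt]; first lra.
have /psumr_eq0P ds : \sum_(f in closed_walks) d f = 0 by lra.
by apply: (proj2 (agm f fw)) => //; apply: ds => // g /agm[].
Qed.

End Nonempty.
End Bound.

(** * Copies of cycles and closed walks *)

(** Each vertex is sent to its class together with its rank within that class. *)
Lemma blowup_iso (G H : sgraph) (m : nat) (cl : G -> H) :
  (forall h, #|[set u | cl u == h]| = m) ->
  (forall u w, adj u w = adj (cl u) (cl w)) ->
  isomorphic G (blowup H m).
Proof.
move=> cardm adjE; pose W h := [set u | cl u == h].
have lt u : index u (enum (W (cl u))) < m.
  by rewrite -(cardm (cl u)) cardE index_mem mem_enum inE.
pose phi u : blowup H m := (cl u, Ordinal (lt u)).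
exists phi; split; last by move=> u w; rewrite /= /blowup_adj adjE.
apply: inj_card_bij.
  move=> u w [ecl eidx].
  have uW : u \in enum (W (cl u)) by rewrite mem_enum inE.
  have wW : w \in enum (W (cl u)) by rewrite mem_enum inE ecl.
  by rewrite -[LHS](nth_index u uW) -[RHS](nth_index u wW) eidx ecl.
rewrite card_prod card_ord -sum_nat_const -sum1_card.
rewrite [leqRHS](partition_big cl predT) //=.
by apply: leq_sum => h _; rewrite sum1dep_card cardm.
Qed.

(** * The [2k] symmetries of the cycle *)

Section Dihedral.
Variable k : nat.
Hypothesis k_ge3 : 3 <= k.

Let k_gt0 : 0 < k. Proof. by lia. Qed.

Lemma modn_lt2 x : x < k.*2 -> x %% k = if x < k then x else x - k.
Proof.
move=> lt; case: ltnP => [/modn_small//|le].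
by rewrite -{1}(subnK le) modnDr modn_small //; lia.
Qed.

(** Free of [modn], so that [lia] can decide adjacency. *)
Lemma cycle_adjE (i j : 'I_k) : cycle_adj i j =
  [|| j == i.+1 :> nat, i == j.+1 :> nat, (i.+1 == k) && (j == 0 :> nat)
    | (j.+1 == k) && (i == 0 :> nat)].
Proof.
rewrite /cycle_adj -!val_eqE /=; have := ltn_ord i; have := ltn_ord j => lj li.
by rewrite !modn_lt2; try lia; case: (ltnP i.+1 k); case: (ltnP j.+1 k); lia.
Qed.

(** The rotation by [p.2], preceded by the reflection of [i] to [- i] when [p.1] holds. *)
Definition dihedral (p : bool * 'I_k) (i : 'I_k) : 'I_k :=
  Ordinal (ltn_pmod (p.2 + (if p.1 then k - i else i)) k_gt0).

Lemma val_dihedral b (s i : 'I_k) : val (dihedral (b, s) i) =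
  (if s + (if b then k - i else i) < k then s + (if b then k - i else i)
   else s + (if b then k - i else i) - k) :> nat.
Proof. by rewrite /= modn_lt2 //; have := ltn_ord i; have := ltn_ord s; case: b; lia. Qed.

Lemma dihedral_adj p i j : cycle_adj (dihedral p i) (dihedral p j) = cycle_adj i j.
Proof.
case: p => b s; rewrite !cycle_adjE !val_dihedral.
have := ltn_ord i; have := ltn_ord j; have := ltn_ord s.
by case: b => ls lj li; case: ltnP => ?; case: ltnP => ?; lia.
Qed.

Lemma dihedral_bij p : bijective (dihedral p).
Proof.
apply: injF_bij => i j; case: p => b s /(congr1 val); rewrite !val_dihedral => e.
apply: val_inj; move: e => /=.
have := ltn_ord i; have := ltn_ord j; have := ltn_ord s.
by case: b => ls lj li; case: ltnP => ?; case: ltnP => ?; lia.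
Qed.

Lemma dihedral_inj p q : dihedral p =1 dihedral q -> p = q.
Proof.
case: p q => [b s] [b' s'] e; have lt1 : 1 < k by lia.
have := congr1 val (e (Ordinal k_gt0)); have := congr1 val (e (Ordinal lt1)).
rewrite !val_dihedral /=; have := ltn_ord s; have := ltn_ord s' => ls' ls e1 e0.
have es : s = s'.
  apply: val_inj => /=; move: e0.
  by case: b {e1 e} => /=; case: b' => /=; repeat case: ltnP => ?; lia.
rewrite -{}es in e1 ls' *; congr pair; move: e1 {e0 e}.
by case: b => /=; case: b' => //=; repeat case: ltnP => ?; lia.
Qed.

Lemma cycle_adjS (i : 'I_k) : cycle_adj i (ordS i).
Proof.
have li := ltn_ord i; rewrite cycle_adjE /= modn_lt2; last lia.
by case: ltnP => ?; lia.
Qed.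

End Dihedral.

Section Copies.
Variables (G : sgraph) (k : nat).
Hypothesis k_ge7 : 7 <= k.

(** Group the closed walks by their image. The fibre over a copy contains its [2k] distinct dihedral
    parametrisations; walks whose image is no copy are dropped. *)
Lemma copies_closed_walks :
  #|copies (cycle_graph k) G| * k.*2 <= #|closed_walks G k|.
Proof.
have k3 : 3 <= k by lia.
rewrite -sum_nat_const -[leqRHS]sum1_card.
rewrite [leqRHS](partition_big (fun f : {ffun 'I_k -> G} => @copy_of (cycle_graph k) G f) predT) //=.
rewrite [leqRHS](bigID (mem (copies (cycle_graph k) G))) /=.
apply: leq_trans (leq_addr _ _); apply: leq_sum => S /copiesP[f [finj fadj ->]].
rewrite sum1dep_card; pose h p : {ffun 'I_k -> G} := [ffun i => f (dihedral k3 p i)].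
have hinj : injective h.
  move=> p q e; apply: (@dihedral_inj _ k3) => i; apply: finj.
  by move/ffunP/(_ i): e; rewrite !ffunE.
have -> : k.*2 = #|[set h p | p : bool * 'I_k]|.
  by rewrite card_imset // card_prod card_bool card_ord mul2n.
apply/subset_leq_card/subsetP=> g /imsetP[p _ ->]; rewrite inE; apply/andP; split.
  rewrite inE; apply/forallP=> i; rewrite !ffunE; apply: fadj.
  by rewrite /= dihedral_adj cycle_adjS.
rewrite -(@copy_of_aut (cycle_graph k) G f (dihedral k3 p)).
- by apply/eqP; rewrite /copy_of; congr pair; [apply: eq_imset|apply: eq_imset] => x; rewrite /= !ffunE.
- exact: dihedral_bij.
- exact: dihedral_adj.
Qed.

End Copies.

(** * The extremal graphs *)

Section Extremal.
Variables (G : sgraph) (k : nat).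
Hypotheses (k_odd : odd k) (k_ge7 : 7 <= k) (noshort : no_short_odd_cycle k G).
Hypothesis G_gt0 : 0 < #|G|.
Hypothesis ratio1 : forall f t, f \in closed_walks G k -> 0 < t < k ->
  cand_ratio k_ge7 f t = 1%R.

Let k_gt0 : 0 < k. Proof. exact: leq_trans k_ge7. Qed.
Let k_ge3 : 3 <= k. Proof. exact: leq_trans k_ge7. Qed.

Lemma card_candidates f t : f \in closed_walks G k -> 0 < t < k ->
  k * ((if t == 1 then 1 else 2) * #|candidates k_ge7 f t|) = 2 * #|G|.
Proof.
move=> fw lt; have := ratio1 fw lt; rewrite /cand_ratio.
move: ((_ : nat) * #|candidates _ _ _|)%N => X e; apply/eqP; rewrite -(@eqr_nat rat) !natrM.
have n0 : (#|G|%:R != 0 :> rat)%R by rewrite pnatr_eq0 -lt0n.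
apply/eqP; transitivity (2%:R * #|G|%:R * (k%:R / #|G|%:R / 2 * X%:R) : rat)%R.
  by field.
by rewrite e mulr1.
Qed.

Lemma degree_on_walk f i : f \in closed_walks G k ->
  k * #|[set u | adj (unroll k_ge7 f i) u]| = 2 * #|G|.
Proof.
move=> fw; have lt : 0 < 1 < k by lia.
have := card_candidates (rotate_closed k_ge7 i fw) lt; rewrite eqxx mul1n => <-.
congr (_ * #|pred_of_set _|); apply/setP=> u; rewrite !inE /cand /= unroll_rotate.
by rewrite /shift addn0.
Qed.

Variable f : {ffun 'I_k -> G}.
Hypothesis fw : f \in closed_walks G k.
Let v := unroll k_ge7 f.
Let cv : closed_walk k v. Proof. exact/closed_walksP. Qed.
Let pv i : v (i + k) = v i. Proof. exact: (proj1 cv). Qed.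

(* The vertices that can replace [v i.+1] on the walk. *)
Let V i := [set u | adj (v i) u && adj (v i.+2) u].

Lemma card_V i : k * #|V i| = #|G|.
Proof.
have lt : 0 < k.-1 < k by lia.
(* Rotating by [i - 1] modulo [k] turns [V i] into the candidate set of the last step. *)
have := card_candidates (rotate_closed k_ge7 (i + k.-1) fw) lt.
rewrite ifF; last lia.
rewrite mulnCA => /eqP; rewrite eqn_mul2l /= => /eqP <-.
congr (_ * #|pred_of_set _|); apply/setP=> u; rewrite !inE cand_last // !unroll_rotate.
rewrite /shift -/v -(pv i) -(pv i.+2).
have -> : i + k.-1 + 1 = i + k by lia.
by have -> : i + k.-1 + 3 = i.+2 + k by lia.
Qed.

(** Otherwise [u] would have two neighbours four places apart on the walk, while 4 is neither 2 nor
    [k - 2]. *)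
Lemma V_uniq i j u : i < k -> j < k -> u \in V i -> u \in V j -> i = j.
Proof.
wlog ltij : i j / i < j.
  move=> H li lj ui uj; case: (ltngtP i j) => // lt; first exact: H.
  by apply/esym/H.
move=> li lj; rewrite !inE => /andP[u1 u2] /andP[u3 u4].
have D := nbr_dist k_odd k_ge7 noshort cv.
have := D _ _ _ u1 u3; have := D _ _ _ u1 u4; have := D _ _ _ u2 u3.
by have := D _ _ _ u3 u2; lia.
Qed.

(** The [k] sets are disjoint and each has size [n / k], so they exhaust the vertices. *)
Lemma V_cover u : exists i : 'I_k, u \in V i.
Proof.
have le1 w : \sum_(i < k) (w \in V i) <= 1.
  case: (pickP (fun i : 'I_k => w \in V i)) => [i wi|none]; last first.
    by rewrite big1 // => i _; rewrite none.
  rewrite (bigD1 i) //= wi big1 ?addn0 // => j ji; case wj: (w \in V j) => //.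
  by case/negP: ji; apply/eqP/val_inj/(V_uniq _ _ wj wi).
have tot : \sum_(w : G) \sum_(i < k) (w \in V i) = \sum_(w : G) 1.
  rewrite exchange_big /= sum1_card.
  apply: (@etrans _ _ (\sum_(i < k) #|V i|)).
    by apply: eq_bigr => i _; rewrite -sum1_card [RHS]big_mkcond.
  rewrite (eq_bigr (fun=> #|V 0|)); last first.
    move=> i _; apply/eqP; rewrite -(eqn_pmul2l k_gt0); by rewrite !card_V.
  by rewrite sum_nat_const card_ord card_V.
have [_] := leqif_sum (fun w (_ : true) => leqif_geq (le1 w)).
rewrite tot eqxx => /esym/forallP/(_ u) /= le.
apply/existsP; apply: contraLR le => /existsPn none.
by rewrite -ltnNge big1 // => i _; rewrite (negPf (none i)).
Qed.

Let cl u : 'I_k := xchoose (V_cover u).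
Let clP u : u \in V (cl u). Proof. exact: xchooseP (V_cover u). Qed.

Lemma clE (i : 'I_k) : [set u | cl u == i] = V i.
Proof.
apply/setP=> u; rewrite inE; apply/eqP/idP => [<-|ui]; first exact: clP.
exact/val_inj/(V_uniq _ _ (clP u) ui).
Qed.

Lemma adj_V i j u w : i <= j < k -> u \in V i -> w \in V j -> adj u w ->
  j = i.+1 \/ (i = 0 /\ j.+1 = k).
Proof.
move=> lt; rewrite !inE => /andP[u1 u2] /andP[w1 w2] uw.
have uw1 : walk 1 u w by rewrite walk1.
have [eij|nij] := eqVneq i j.
  have w2' : walk (1 + 1) u w.
    by apply: (@walk_cat _ _ _ _ (v i)); rewrite walk1; [rewrite adj_sym | rewrite eij].
  by have := walk_parity noshort w2' uw1; lia.
(* Besides the triangle for [i = j], the edge closes an odd walk with one of the two arcs: the one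
   past [v k] if [j - i] is odd, the direct one if it is even. *)
case od : (odd (j - i)).
  have [->|nj] := eqVneq j i.+1; first by left.
  have le : j.+2 <= i + k by lia.
  have := adj_walk_fwd cv w2 le; rewrite pv => wi.
  have iu : walk 1 (v i) u by rewrite walk1.
  have := walk_parity noshort (walk_sym (walk_cat wi iu)) uw1; lia.
have le : i.+2 <= j by lia.
have uj := adj_walk_fwd cv u2 le.
have jw : walk 1 (v j) w by rewrite walk1.
have := walk_parity noshort (walk_cat uj jw) uw1; lia.
Qed.

Lemma adj_cl u w : adj u w -> cycle_adj (cl u) (cl w).
Proof.
move=> uw; rewrite cycle_adjE //.
have lu := ltn_ord (cl u); have lw := ltn_ord (cl w).
have := adj_V _ (clP u) (clP w) uw; rewrite adj_sym in uw.
by have := adj_V _ (clP w) (clP u) uw; lia.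
Qed.

(* Replacing [v (cl u).+1] by [u] gives a closed walk through [u]. *)
Lemma degree (u : G) : k * #|[set w | adj u w]| = 2 * #|G|.
Proof.
have := clP u; rewrite inE; set i := cl u => /andP[u1 u2].
pose j := ordS i; pose g := [ffun x => if x == j then u else f x].
have ej : v j = v i.+1 by rewrite v_mod.
have gw : g \in closed_walks G k.
  rewrite inE; apply/forallP=> x; rewrite !ffunE.
  have fx y : f y = v y by rewrite /v unroll_ord.
  have vS (y : 'I_k) : v (ordS y) = v y.+1 by rewrite v_mod.
  case: ifP => [/eqP->|xj]; case: ifP => [/eqP e|xj'].
  - by have := cycle_adjS k_ge3 j; rewrite e cycle_adj_irr.
  - rewrite fx vS adj_sym; congr (is_true (adj _ _)): u2.
    by rewrite -addn1 -[in RHS]addn1 -(v_mod cv) -[RHS](v_mod cv) /= modnDml addn1.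
  - rewrite fx.
    by have -> : x = i by apply: (@ordS_inj k).
  - by rewrite !fx vS; apply: (proj2 cv).
have := degree_on_walk j gw.
by rewrite unroll_ord ffunE eqxx.
Qed.

(** All neighbours of [u] lie in the two classes next to its own. These have total size [2n / k],
    which is the degree of [u], so every vertex in them is a neighbour. *)
Lemma adj_clE u w : adj u w = cycle_adj (cl u) (cl w).
Proof.
pose N := [set w | adj u w]; pose A := [set w | cycle_adj (cl u) (cl w)].
have NA : N \subset A by apply/subsetP=> x; rewrite !inE; apply: adj_cl.
have AU : A \subset V (ordS (cl u)) :|: V (ord_pred (cl u)).
  apply/subsetP=> x; rewrite in_setU -!clE !inE => /andP[_ /orP[]/eqP e].
    by rewrite e eqxx.
  by rewrite e ordSK eqxx orbT.
have leA : #|A| <= #|N|.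
  rewrite -(leq_pmul2l k_gt0) degree; apply: leq_trans (leq_mul (leqnn k) (subset_leq_card AU)) _.
  apply: leq_trans (leq_mul (leqnn k) (leq_card_setU _ _)) _.
  by rewrite mulnDr !card_V mul2n addnn.
have /eqP/setP/(_ w) : N == A by rewrite eqEcard NA leA.
by rewrite !inE.
Qed.

Lemma extremal_blowup : is_balanced_cycle_blowup k G.
Proof.
have dv : k %| #|G| by rewrite -(card_V 0) dvdn_mulr.
split=> //; apply: (@blowup_iso G (cycle_graph k) _ cl); last exact: adj_clE.
by move=> i; rewrite clE -(card_V i) mulKn.
Qed.

End Extremal.

(** * The blow-up has no short odd cycles and attains the bound *)

(** Here [a] counts the forward steps and [b] the backward ones. *)
Lemma cycle_walk_drift (k : nat) (h : nat -> 'I_k) (t : nat) :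
  (forall s, cycle_adj (h s) (h s.+1)) ->
  exists a b, a + b = t /\ h t + b = h 0 + a %[mod k].
Proof.
move=> hadj; elim: t => [|t [a [b [ab e]]]]; first by exists 0, 0.
case/andP: (hadj t) => _ /orP[]/eqP eS.
  exists a.+1, b; split; first by rewrite addSn ab.
  rewrite eS /= modnDml addSn addnS -[(h t + b).+1]addn1 -[(h 0 + a).+1]addn1.
  by rewrite -modnDml e modnDml.
exists a, b.+1; split; first by rewrite addnS ab.
by rewrite -e eS /= modnDml addSnnS.
Qed.

Lemma blowup_no_short_odd_cycle (k : nat) (G : sgraph) (m : nat) :
  isomorphic G (blowup (cycle_graph k) m) -> no_short_odd_cycle k G.
Proof.
case=> phi [_ phiadj] l l_odd l_ge3 ltlk; apply/eqP; rewrite -[_ == _]negbK.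
apply/negP=> /set0Pn[S /copiesP[f [_ fadj _]]].
have l_gt0 : 0 < l by apply: leq_trans l_ge3.
pose h t : 'I_k := (phi (f (Ordinal (ltn_pmod t l_gt0)))).1.
have hadj s : cycle_adj (h s) (h s.+1).
  pose i : 'I_l := Ordinal (ltn_pmod s l_gt0).
  have eS : Ordinal (ltn_pmod s.+1 l_gt0) = ordS i.
    by apply: val_inj; rewrite /= -addn1 -[in RHS]addn1 modnDml.
  have : adj (phi (f i)) (phi (f (ordS i))) by rewrite phiadj fadj //; apply: cycle_adjS.
  by rewrite /h eS.
have [a [b [ab]]] := cycle_walk_drift l hadj.
have -> : h l = h 0 by congr (phi (f _)).1; apply: val_inj; rewrite /= modnn mod0n.
(* Both [a] and [b] are below [k], so they are equal, and [l] would be even. *)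
by move/eqP; rewrite eqn_modDl !modn_small; lia.
Qed.

(** Choosing one vertex in each class gives a copy, whose vertex set determines the choice. *)
Lemma card_copies_blowup (k : nat) (G : sgraph) (m : nat) :
  isomorphic G (blowup (cycle_graph k) m) -> m ^ k <= #|copies (cycle_graph k) G|.
Proof.
case=> phi [[psi phiK psiK] phiadj].
pose e (h : {ffun 'I_k -> 'I_m}) (i : cycle_graph k) : G := psi (i, h i).
have e_copy h : copy_of (e h) \in copies (cycle_graph k) G.
  apply: copy_of_in_copies => [i j /(can_inj psiK)[]//|i j ij].
  by rewrite -phiadj !psiK.
have e_inj : injective (fun h => copy_of (e h)).
  move=> h h' [/setP eV _]; apply/ffunP=> i.
  have := eV (e h i); rewrite imset_f // => /esym/imsetP[j _ /(can_inj psiK)[]].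
  by move=> <- ->.
have -> : m ^ k = #|[set copy_of (e h) | h : {ffun 'I_k -> 'I_m}]|.
  by rewrite card_imset // card_ffun !card_ord.
by apply/subset_leq_card/subsetP=> S /imsetP[h _ ->]; apply: e_copy.
Qed.

(** * The bound and the case of equality *)

Local Open Scope ring_scope.

Lemma copies_empty (k : nat) (G : sgraph) :
  (7 <= k)%N -> #|G| = 0%N -> #|copies (cycle_graph k) G| = 0%N.
Proof.
move=> k_ge7 G0; have := copies_closed_walks G k_ge7.
have -> : #|closed_walks G k| = 0%N.
  by apply/eqP; rewrite -leqn0 (leq_trans (max_card _)) // card_ffun G0 card_ord exp0n //; lia.
by rewrite leqn0 muln_eq0 => /orP[/eqP//|]; lia.
Qed.

Lemma copies_le (k : nat) (G : sgraph) : odd k -> (7 <= k)%N -> no_short_odd_cycle k G ->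
  #|copies (cycle_graph k) G|%:R <= (#|G|%:R / k%:R) ^+ k :> rat.
Proof.
move=> k_odd k_ge7 ns; have [G0|G_gt0] := posnP #|G|.
  by rewrite copies_empty // exprn_ge0 // divr_ge0 ?ler0n.
have [le _] := card_closed_walks k_odd k_ge7 ns G_gt0.
have := copies_closed_walks G k_ge7; rewrite -(ler_nat rat) natrM -mul2n natrM => le2.
have k0 : 0 < 2 * k%:R :> rat by rewrite mulr_gt0 // ltr0n; lia.
by rewrite -(ler_pM2l k0) mulrC (le_trans le2).
Qed.

Theorem theorem1 (k : nat) (k_odd : odd k) (k_ge7 : (7 <= k)%N) (G : sgraph) :
  (no_short_odd_cycle k G ->
     #|copies (cycle_graph k) G|%:R <= (#|G|%:R / k%:R) ^+ k :> rat)
  /\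
  (no_short_odd_cycle k G /\
     #|copies (cycle_graph k) G|%:R = (#|G|%:R / k%:R) ^+ k :> rat
   <-> is_balanced_cycle_blowup k G).
Proof.
have k_gt0 : (0 < k)%N by apply: leq_trans k_ge7.
split; first exact: copies_le.
split=> [[ns eq]|[dv iso]]; last first.
  have ns := blowup_no_short_odd_cycle iso; split=> //.
  apply/eqP; rewrite eq_le copies_le //=.
  have -> : #|G|%:R / k%:R = (#|G| %/ k)%N%:R :> rat.
    by rewrite -{1}(divnK dv) natrM mulfK // pnatr_eq0 -lt0n.
  by rewrite -natrX ler_nat card_copies_blowup.
(* The empty graph is the blow-up with empty classes. *)
have [G0|G_gt0] := posnP #|G|.
  have noG (u : G) : False.
    by have : (0 < #|G|)%N by [apply/card_gt0P; exists u]; rewrite G0.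
  split; first by rewrite G0.
  apply: (@blowup_iso G (cycle_graph k) _ (fun=> Ordinal k_gt0 : cycle_graph k)).
    move=> h; apply/eqP; rewrite G0 div0n cards_eq0; apply/eqP/setP=> u.
    by case: (noG u).
  by move=> u; case: (noG u).
have [_ ratio1] := card_closed_walks k_odd k_ge7 ns G_gt0.
have le2 : 2 * k%:R * (#|G|%:R / k%:R) ^+ k <= #|closed_walks G k|%:R :> rat.
  rewrite -eq -!natrM ler_nat mul2n mulnC; exact: copies_closed_walks.
(* Equality makes the number of closed walks positive, which supplies the walk around which the
   classes are built. *)
have /card_gt0P[f fw] : (0 < #|closed_walks G k|)%N.
  rewrite -(ltr_nat rat); apply: lt_le_trans le2.
  by rewrite mulr_gt0 ?exprn_gt0 ?divr_gt0 ?mulr_gt0 ?ltr0n.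
exact: (extremal_blowup k_odd ns G_gt0 (ratio1 le2) fw).
Qed.
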